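(* For $\lambda>0$ let $N_\lambda$ be a Poisson random variable with parameter $\lambda$. Then $$\inf_{\lambda>0}P\left\{|N_\lambda-E[N_\lambda]|<\sqrt{\mathrm{Var}(N_\lambda)}\right\}=P\left\{|N_1-E[N_1]|<\sqrt{\mathrm{Var}(N_1)}\right\}=e^{-1}.$$ Consequently, with $\mathcal I_0$ the set of all infinitely divisible real random variables $X$ with $E[X^2]<\infty$ and $\mathrm{Var}(X)>0$, and $P_{\mathcal I_0}=\inf_{X\in\mathcal I_0}P\{|X-E[X]|<\sqrt{\mathrm{Var}(X)}\}$, we have $P_{\mathcal I_0}\le e^{-1}$.
   Context: A real random variable is infinitely divisible if for every $n\ge1$ its distribution equals that of a sum of $n$ i.i.d. random variables. *)

(* Defs.v *)
From HB Require Import structures.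
From mathcomp Require Import all_boot all_order all_algebra.
From mathcomp Require Import all_classical all_reals all_analysis.
Set Implicit Arguments. Unset Strict Implicit. Unset Printing Implicit Defensive.
Import Order.TTheory GRing.Theory Num.Def Num.Theory.
Import numFieldNormedType.Exports.
Local Open Scope classical_set_scope.
Local Open Scope ring_scope.

(* X (real random variable) is Poisson with parameter rate: its law is the
   image of the Poisson probability on nat under the inclusion nat -> R.
   (The second argument of poisson_prob is unused by the library.) *)
Definition is_poisson d (T : measurableType d) (R : realType)
  (P : probability T R) (X : {RV P >-> R}) (rate : R) : Prop :=
  forall A : set R, measurable A ->
    distribution P X A = poisson_prob rate 0%N ((fun k : nat => k%:R) @^-1` A).

Definition centered_prob d (T : measurableType d) (R : realType)
  (P : probability T R) (X : {RV P >-> R}) : R :=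
  fine (P [set w | `|X w - fine 'E_P[X]| < Num.sqrt (fine 'V_P[X])]).

Definition mutually_independent d (T : measurableType d) (R : realType)
  (P : probability T R) (n : nat) (Y : 'I_n -> {RV P >-> R}) : Prop :=
  forall (J : {set 'I_n}) (B : 'I_n -> set R), (forall i, measurable (B i)) ->
    P (\bigcap_(i in [set i | i \in J]) (Y i @^-1` B i)) =
    (\prod_(i in J) P (Y i @^-1` B i))%E.

Definition infinitely_divisible d (T : measurableType d) (R : realType)
  (P : probability T R) (X : {RV P >-> R}) : Prop :=
  forall n : nat, (0 < n)%N ->
    exists (d' : measure_display) (T' : measurableType d')
           (P' : probability T' R) (Y : 'I_n -> {RV P' >-> R}),
      [/\ mutually_independent Y,
          (forall (i j : 'I_n) (A : set R), measurable A ->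
             P' (Y i @^-1` A) = P' (Y j @^-1` A)) &
          (forall A : set R, measurable A ->
             P (X @^-1` A) = P' ((fun w => \sum_(i < n) Y i w) @^-1` A))].

Definition I0_probs (R : realType) : set R :=
  [set p | exists (d : measure_display) (T : measurableType d)
                  (P : probability T R) (X : {RV P >-> R}),
     [/\ infinitely_divisible X,
         ('E_P[(fun w => (X w ^+ 2)%R)] < +oo)%E,
         (0 < 'V_P[X])%E &
         p = centered_prob X]].

(* Main.v *)
(* Write [w_k = l ^ k / k!] for the weight of [k].  For [l <= 1] the central
   interval contains 0 (or, for [l = 1], only 1).  For [l > 1], put
   [s = sqrt l], let [a] be the largest integer with [a <= l - s] and [p] the
   largest with [p < l + s].  The recurrence [(k + 1) w_(k+1) = l w_k] bounds
   the left tail by [(a + 1) / (l - a) * w_(a+1)] and the right tail by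
   [(p + 2) / (p + 2 - l) * w_(p+1)].  The weights increase up to [l] and
   decrease afterwards, so each tail is at most 5/3 times the part of the
   central mass on its side of [l].  Hence the central mass is at least
   [3 / 8 >= 1 / e] of the total.  A Poisson variable with rate 1 is a sum of
   [n] independent Poisson variables with rate [1 / n], so [1 / e] is attained
   by an infinitely divisible law. *)
Require Import Defs.
From HB Require Import structures.
From mathcomp Require Import all_boot all_order all_algebra.
From mathcomp Require Import all_classical all_reals all_analysis.
From mathcomp Require Import measurable_realfun ring lra.
Import Order.TTheory GRing.Theory Num.Def Num.Theory.
Import numFieldNormedType.Exports.
Set Implicit Arguments.
Unset Strict Implicit.
Unset Printing Implicit Defensive.
Local Open Scope classical_set_scope.
Local Open Scope ring_scope.

(** * Terms and partial sums of the exponential series *)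

Lemma exp_coeffS (R : realType) (x : R) (k : nat) :
  k.+1%:R * exp_coeff x k.+1 = x * exp_coeff x k.
Proof.
rewrite /exp_coeff /= exprS factS natrM invfM.
by rewrite mulrCA mulVKf ?pnatr_eq0// mulrA.
Qed.

(** Reduces an upper bound on [expR] to finite sums, so that the right tail can be handled as a
    finite sum. *)
Lemma expR_le_series (R : realType) (x b : R) (m : nat) :
  (forall n, (m <= n)%N -> \sum_(0 <= k < n) exp_coeff x k <= b) ->
  expR x <= b.
Proof.
move=> xb; apply: limr_le; first exact: is_cvg_series_exp_coeff.
by exists m => // n /= mn; exact: xb.
Qed.

Lemma series_le_expR (R : realType) (x : R) (n : nat) :
  0 <= x -> \sum_(0 <= k < n) exp_coeff x k <= expR x.
Proof.
move=> x0; apply: (@nondecreasing_cvgn_le _ (series (exp_coeff x))).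
  apply: nondecreasing_series => k _ _; exact: exp_coeff_ge0.
exact: is_cvg_series_exp_coeff.
Qed.

(** The first four terms, 1 + 1 + 1/2 + 1/6, add up to exactly 8/3. *)
Lemma expR1_ge (R : realType) : 8 / 3 <= expR 1 :> R.
Proof.
apply: le_trans (series_le_expR 4 ler01).
rewrite !big_nat_recr//= big_nil /exp_coeff /= !expr1n !factS fact0 !natrM.
lra.
Qed.

(** By the recurrence, [(x - k) w_k = x w_k - x w_(k-1)] telescopes; then [x - k] is at least
    [x - a] for [k <= a]. *)
Lemma exp_coeff_left_tail (R : realType) (x : R) (a : nat) : 0 <= x ->
  (x - a%:R) * \sum_(0 <= k < a.+1) exp_coeff x k <= a.+1%:R * exp_coeff x a.+1.
Proof.
move=> x0.
have tel : \sum_(0 <= k < a.+1) (x - k%:R) * exp_coeff x k = x * exp_coeff x a.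
  elim: a => [|a ih]; first by rewrite big_nat1 subr0.
  by rewrite big_nat_recr//= ih -exp_coeffS; ring.
rewrite exp_coeffS -tel mulr_sumr big_nat [leRHS]big_nat.
apply: ler_sum => k /andP[_ ka]; rewrite ler_wpM2r ?exp_coeff_ge0//.
by rewrite lerB// ler_nat.
Qed.

Lemma exp_coeff_right_tail (R : realType) (x : R) (m n : nat) : 0 <= x ->
  (m <= n)%N ->
  (m.+1%:R - x) * \sum_(m <= k < n) exp_coeff x k <= m.+1%:R * exp_coeff x m.
Proof.
(* The extra term [m.+1%:R * exp_coeff x n] makes the induction on [n] close: it pays for the
   summand that the next step adds. *)
move=> x0 mn; suff: (m.+1%:R - x) * \sum_(m <= k < n) exp_coeff x k
    + m.+1%:R * exp_coeff x n <= m.+1%:R * exp_coeff x m.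
  by apply: le_trans; rewrite lerDl mulr_ge0 ?exp_coeff_ge0.
elim: n mn => [|n ih].
  by rewrite leqn0 => /eqP ->; rewrite big_geq//; lra.
rewrite leq_eqVlt => /predU1P[<-|]; first by rewrite big_geq//; lra.
rewrite ltnS => mn; rewrite big_nat_recr//=.
apply: le_trans (ih mn); rewrite mulrDr -addrA lerD2l.
have : m.+1%:R * exp_coeff x n.+1 <= x * exp_coeff x n.
  by rewrite -exp_coeffS ler_wpM2r ?exp_coeff_ge0// ler_nat.
lra.
Qed.

Lemma exp_coeff_nondecreasing (R : realType) (x : R) (i j : nat) : 0 <= x ->
  (i <= j)%N -> j%:R <= x -> exp_coeff x i <= exp_coeff x j.
Proof.
move=> x0; elim: j => [|j ih]; first by rewrite leqn0 => /eqP ->.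
rewrite leq_eqVlt => /predU1P[->//|]; rewrite ltnS => ij jx.
apply: le_trans (ih ij _) _; first by apply: le_trans jx; rewrite ler_nat.
rewrite -(@ler_pM2l _ j.+1%:R)// exp_coeffS.
by rewrite ler_wpM2r ?exp_coeff_ge0.
Qed.

Lemma exp_coeff_nonincreasing (R : realType) (x : R) (i j : nat) : 0 <= x ->
  (i <= j)%N -> x <= i.+1%:R -> exp_coeff x j <= exp_coeff x i.
Proof.
move=> x0 ij xi; elim: j ij => [|j ih]; first by rewrite leqn0 => /eqP ->.
rewrite leq_eqVlt => /predU1P[->//|]; rewrite ltnS => ij.
apply: le_trans (ih ij).
rewrite -(@ler_pM2l _ j.+1%:R)// exp_coeffS.
rewrite ler_wpM2r ?exp_coeff_ge0//.
by apply: le_trans xi _; rewrite ler_nat.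
Qed.

(** * The central block against the two tails *)

Lemma ler_sum_nat_const (R : realType) (f : nat -> R) (c : R) (i j : nat) :
  (i <= j)%N ->
  (forall k, (i <= k < j)%N -> c <= f k) ->
  (j%:R - i%:R) * c <= \sum_(i <= k < j) f k.
Proof.
move=> ij cf; rewrite big_nat -natrB// mulr_natl -sumr_const_nat big_nat.
exact: ler_sum.
Qed.

Lemma natceil_ex (R : realType) (x : R) : 0 < x ->
  exists m : nat, m%:R < x <= m.+1%:R.
Proof.
move=> x0; have exm : exists n : nat, x <= n%:R.
  by exists (truncn x).+1; rewrite ltW// truncnS_gt.
case: (ex_minnP exm) => -[|m] xm minm; first by move: xm; rewrite leNgt x0.
exists m; rewrite xm andbT ltNge; apply/negP => /minm; by rewrite ltnn.
Qed.

(* With [l = s ^+ 2], the factor [(a + 1) / (l - a)] bounds the tail at or below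
   [a] relative to the weight of [a + 1], and at least [M - a] integers of
   ]l - s, l] carry at least that weight. *)
Lemma left_tail_factor (R : realFieldType) (l s a M : R) : 1 < s ->
  l = s ^+ 2 -> a <= l - s -> l < M + 1 -> a + 1 <= M ->
  a + 1 <= 5 / 3 * (M - a) * (l - a).
Proof.
move=> s1 ls al lM aM1.
have : 5 / 3 * (M - a) * s <= 5 / 3 * (M - a) * (l - a).
  by rewrite ler_wpM2l//; lra.
have : s ^+ 2 - s + 1 <= 5 / 3 * (M - a) * s.
  (* Both [M - a >= 1] and [M - a > s - 1] hold. The first suffices up to [s = 2], where the two
     bounds agree, and the second beyond. *)
  have [s2|s2] := lerP s 2.
    have : s <= (M - a) * s by rewrite ler_peMl; lra.
    have : 0 <= (2 - s) * (s - 1 / 2) by rewrite mulr_ge0; lra.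
    lra.
  have : (s - 1) * s <= (M - a) * s by rewrite ler_wpM2r; lra.
  have : 0 <= (s - 2) * (s + 1) by rewrite mulr_ge0; lra.
  lra.
lra.
Qed.

(** The right tail is at most [(p + 2) / (p + 2 - l)] times the weight of [p + 1], which is
    [l / (p + 1)] times that of [p]; the [p - M] integers of ]l, l + s[ each carry at least the
    weight of [p]. *)
Lemma right_tail_factor (R : realFieldType) (l s p M : R) : 1 < s ->
  l = s ^+ 2 -> l + s <= p + 1 -> M <= l -> M + 1 <= p ->
  (p + 1 + 1) * l <= 5 / 3 * (p - M) * ((p + 1) * (p + 1 + 1 - l)).
Proof.
move=> s1 ls; set q := p + 1 => lq Ml Mp1; have qE : q = p + 1 by [].
(* Equivalent to [l + s <= q]: the quotient [(q + 1) / q] is replaced by its value at [q = l + s],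
   after which [l + s = s * (s + 1)] lets [h2] finish the estimate. *)
have h1 : (q + 1) * (l + s) <= (l + s + 1) * q by lra.
have h2 : s * (l + s + 1) <= 5 / 3 * (p - M) * (s + 1) ^+ 2.
  have [s2|s2] := lerP s 2.
    have : (s + 1) ^+ 2 <= (p - M) * (s + 1) ^+ 2.
      by rewrite ler_peMl ?sqr_ge0//; lra.
    have : 0 <= (2 - s) * (s + 1) ^+ 2 by rewrite mulr_ge0 ?sqr_ge0//; lra.
    nra.
  have : (s - 1) * (s + 1) ^+ 2 <= (p - M) * (s + 1) ^+ 2.
    by rewrite ler_wpM2r ?sqr_ge0//; lra.
  have : 0 <= (s - 2) * s ^+ 2 by rewrite mulr_ge0 ?sqr_ge0//; lra.
  nra.
have h3 : (q + 1) * l <= 5 / 3 * (p - M) * (s + 1) * q.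
  have s0 : 0 < s + 1 by lra.
  rewrite -(ler_pM2l s0).
  have : s * ((q + 1) * (l + s)) <= s * ((l + s + 1) * q).
    by apply: ler_wpM2l => //; lra.
  have : s * (l + s + 1) * q <= 5 / 3 * (p - M) * (s + 1) ^+ 2 * q.
    by apply: ler_wpM2r => //; nra.
  rewrite ls; lra.
apply: le_trans h3 _; rewrite -(mulrA _ (s + 1)).
apply: ler_wpM2l; first lra.
by rewrite mulrC ler_wpM2l//; nra.
Qed.

Lemma exp_coeff_central (R : realType) (l : R) : 1 < l ->
  exists a m : nat,
    (forall k, (a < k < m)%N -> `|k%:R - l| < Num.sqrt l) /\
    expR l <= 8 / 3 * \sum_(a.+1 <= k < m) exp_coeff l k.
Proof.
move=> l1; have l0 : 0 <= l by lra.
set s := Num.sqrt l.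
have ls : l = s ^+ 2 by rewrite sqr_sqrtr.
have s1 : 1 < s by rewrite -(@sqrtr1 R) ltr_sqrt//; lra.
set a := truncn (l - s); set M := truncn l.
have /andP[al la] : a%:R <= l - s < a.+1%:R.
  by apply: truncn_itv; rewrite ls; nra.
have /andP[Ml lM] : M%:R <= l < M.+1%:R by apply: truncn_itv.
(* Unlike truncation, this keeps [p] strictly below [l + s] even when [l + s] is an integer, as the
   open interval demands. *)
have [p /andP[pl lp]] := @natceil_ex _ (l + s) ltac:(lra).
rewrite -natr1 in la; rewrite -natr1 in lM; rewrite -natr1 in lp.
have aM : (a < M)%N.
  by rewrite -ltnS -(ltr_nat R) -natr1 -(natr1 M); lra.
have Mp : (M < p)%N by rewrite -(ltr_nat R); lra.
exists a, p.+1; split.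
  move=> k /andP[ak kp].
  have : a.+1%:R <= k%:R :> R by rewrite ler_nat.
  have : k%:R <= p%:R :> R by rewrite ler_nat.
  rewrite -natr1 => ? ?.
  by rewrite ltr_norml; apply/andP; split; lra.
apply: (@expR_le_series _ _ _ p.+1) => n pn.
(* Cuts at [a.+1], [M.+1] and [p.+1] give left tail, two central halves and right tail; 8/3 is 1 +
   5/3. *)
rewrite (@big_cat_nat _ _ _ p.+1)//=.
rewrite (@big_cat_nat _ _ _ a.+1 0 p.+1)//=; last first.
  by rewrite ltnS ltnW// (ltn_trans aM).
rewrite (@big_cat_nat _ _ _ M.+1 a.+1 p.+1)//=; [|exact: ltnW|exact: ltnW].
have HL := exp_coeff_left_tail a l0.
have HR := exp_coeff_right_tail l0 pn.
have LI : (M.+1%:R - a.+1%:R) * exp_coeff l a.+1 <=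
    \sum_(a.+1 <= k < M.+1) exp_coeff l k.
  apply: ler_sum_nat_const => [|k /andP[ak kM]]; first exact: ltnW.
  apply: exp_coeff_nondecreasing => //; apply: le_trans Ml.
  by rewrite ler_nat -ltnS.
have RI : (p.+1%:R - M.+1%:R) * exp_coeff l p <=
    \sum_(M.+1 <= k < p.+1) exp_coeff l k.
  apply: ler_sum_nat_const => [|k /andP[ak kM]]; first exact: ltnW.
  apply: exp_coeff_nonincreasing => //.
  rewrite (le_trans (ltW lM))// natr1 ler_nat.
  by rewrite (leq_trans ak).
have pS := exp_coeffS l p.
have w0 : 0 <= exp_coeff l a.+1 by apply: exp_coeff_ge0.
have v0 : 0 <= exp_coeff l p by apply: exp_coeff_ge0.
set OL := \sum_(0 <= _ < _) _ in HL *; set OR := \sum_(p.+1 <= _ < _) _ in HR *.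
set IL := \sum_(_ <= _ < M.+1) _ in LI *.
set IR := \sum_(M.+1 <= _ < _) _ in RI *.
have aM1 : a%:R + 1 <= M%:R :> R by rewrite natr1 ler_nat.
have Mp1 : M%:R + 1 <= p%:R :> R by rewrite natr1 ler_nat.
have FL := left_tail_factor s1 ls al lM aM1.
have FR := right_tail_factor s1 ls lp Ml Mp1.
suff : OL <= 5 / 3 * IL /\ OR <= 5 / 3 * IR by move=> [? ?]; lra.
move: LI RI pS HR HL.
rewrite -!(natr1 a) -!(natr1 M) -!(natr1 p.+1) -!(natr1 p).
move=> LI RI pS HR HL; split.
  have la0 : 0 < l - a%:R by lra.
  rewrite -(ler_pM2l la0); apply: le_trans HL _.
  apply: le_trans (ler_wpM2r w0 FL) _.
  have := ler_wpM2l (ltW la0) LI; lra.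
(* The tail bound involves the weight of [p + 1]; multiplying by [p + 1] turns it into [l] times the
   weight of [p], which [RI] controls. *)
have q0 : 0 < p%:R + 1 :> R by rewrite natr1.
have lq0 : 0 < (p%:R + 1) * (p%:R + 1 + 1 - l) by rewrite mulr_gt0//; lra.
rewrite -(ler_pM2l lq0).
have := ler_wpM2l (ltW q0) HR.
have := ler_wpM2r v0 FR.
have := ler_wpM2l (ltW lq0) RI.
have : (p%:R + 1 + 1) * ((p%:R + 1) * exp_coeff l p.+1) =
    (p%:R + 1 + 1) * (l * exp_coeff l p) by rewrite pS.
lra.
Qed.

(** * Integration and moments for the Poisson law on [nat] *)

Lemma poisson_pmfE (R : realType) (l : R) (k : nat) : 0 < l ->
  poisson_pmf l k = exp_coeff l k * expR (- l).
Proof. by rewrite /poisson_pmf => ->. Qed.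

Lemma poisson_probE (R : realType) (l : R) (j : nat) (A : set nat) : 0 < l ->
  poisson_prob l j A = (\esum_(k in A) (poisson_pmf l k)%:E)%E.
Proof. by rewrite /poisson_prob => ->. Qed.

Lemma poisson_prob1 (R : realType) (l : R) (j k : nat) : 0 < l ->
  poisson_prob l j [set k] = (poisson_pmf l k)%:E.
Proof.
by move=> l0; rewrite poisson_probE// esum_set1// lee_fin poisson_pmf_ge0.
Qed.

Lemma trivIset_singletons (I : Type) (D : set I) :
  trivIset D (fun i => [set i]).
Proof. by move=> i j _ _ [x [/= <- <-]]. Qed.

Lemma ge0_integral_nat (R : realType) (mu : {measure set nat -> \bar R})
    (f : nat -> \bar R) : (forall k, 0 <= f k)%E ->
  (\int[mu]_k f k = \sum_(k <oo) f k * mu [set k])%E.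
Proof.
move=> f0.
have nE : \bigcup_k [set k] = [set: nat] by rewrite bigcup_imset1 image_id.
rewrite -nE ge0_integral_bigcup//; last exact: trivIset_singletons.
apply: eq_eseriesr => k _.
rewrite (eq_integral (cst (f k))); last by move=> x /[!inE] /= ->.
by rewrite integral_cst//.
Qed.

Lemma integral_poisson (R : realType) (l : R) (j : nat) (f : nat -> \bar R) :
  0 < l -> (forall k, 0 <= f k)%E ->
  (\int[poisson_prob l j]_k f k = \sum_(k <oo) f k * (poisson_pmf l k)%:E)%E.
Proof.
move=> l0 f0; rewrite ge0_integral_nat//.
by apply: eq_eseriesr => k _; congr (_ * _)%E; exact: poisson_prob1.
Qed.

(* The Chen-Stein identity, from which all moments below follow. *)
Lemma integral_poisson_shift (R : realType) (l : R) (j : nat) (g : nat -> R) :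
  0 < l -> (forall k, 0 <= g k) ->
  (\int[poisson_prob l j]_k (k%:R * g k)%:E =
   l%:E * \int[poisson_prob l j]_k (g k.+1)%:E)%E.
Proof.
move=> l0 g0; rewrite !integral_poisson//; last 2 first.
- by move=> k; rewrite lee_fin.
- by move=> k; rewrite lee_fin mulr_ge0.
rewrite -nneseriesZl; last first.
  by move=> k _; rewrite -EFinM lee_fin mulr_ge0// poisson_pmf_ge0.
(* The term at 0 vanishes through the factor [k], so the series can be reindexed by one. *)
rewrite (nneseries_split 0 1); last first.
  by move=> k _; rewrite -EFinM lee_fin !mulr_ge0// poisson_pmf_ge0.
rewrite big_mkord big_ord1 !mul0r mul0e add0e add0n.
rewrite -(nneseries_addn 1); last first.
  by move=> k; rewrite -EFinM lee_fin !mulr_ge0// poisson_pmf_ge0.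
apply: eq_eseriesr => k _; rewrite addn1 -!EFinM; congr EFin.
rewrite !poisson_pmfE//.
rewrite [LHS](_ : _ =
  g k.+1 * (k.+1%:R * exp_coeff l k.+1) * expR (- l)); last by ring.
by rewrite exp_coeffS; ring.
Qed.

Section poisson_moments.
Variables (R : realType) (l : R).
Hypothesis l0 : 0 < l.
Let mu := poisson_prob l 0.

Lemma poisson_mean : (\int[mu]_k k%:R%:E = l%:E)%E.
Proof.
under eq_integral => k _ do rewrite -[k%:R]mulr1.
rewrite (@integral_poisson_shift _ _ _ (fun=> 1))//.
by rewrite integral_cst// [X in (_ * (_ * X))%E]probability_setT !mule1.
Qed.

Lemma poisson_second_moment : (\int[mu]_k (k%:R ^+ 2)%:E = (l * (l + 1))%:E)%E.
Proof.
rewrite (@integral_poisson_shift _ _ _ (fun k => k%:R))//.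
under eq_integral do rewrite -natr1 EFinD.
rewrite ge0_integralD//.
rewrite poisson_mean integral_cst// [X in (_ * (_ + _ * X))%E]probability_setT.
by rewrite mule1.
Qed.

Lemma poisson_variance : (\int[mu]_k ((k%:R - l) ^+ 2)%:E = l%:E)%E.
Proof.
have l2k (k : nat) : (0 <= (2 * l * k%:R)%:E)%E.
  by rewrite lee_fin !mulr_ge0// ltW.
(* The cross term of the square is moved to the left, so that every integrand is nonnegative and
   additivity needs no integrability. *)
have : (\int[mu]_k ((k%:R - l) ^+ 2)%:E + \int[mu]_k (2 * l * k%:R)%:E =
    \int[mu]_k (k%:R ^+ 2)%:E + \int[mu]_k cst (l ^+ 2)%:E k)%E.
  rewrite -!ge0_integralD//; try by move=> k _; rewrite lee_fin sqr_ge0.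
  by apply: eq_integral => k _; rewrite /= -!EFinD; congr EFin; ring.
rewrite poisson_second_moment integral_cst//.
rewrite [X in (_ = _ + _ * X)%E]probability_setT mule1.
under [X in (_ + X)%E]eq_integral do rewrite EFinM.
rewrite ge0_integralZl//; last by rewrite lee_fin mulr_ge0// ltW.
rewrite poisson_mean -EFinM -EFinD.
(* An infinite value would contradict the finite right-hand side. *)
case: (integral _ _ _) => [r| |]//= [] h; congr EFin; lra.
Qed.

End poisson_moments.

(** * Transfer to random variables with a Poisson law *)

Section poisson_rv.
Context d (T : measurableType d) (R : realType) (P : probability T R).
Variables (X : {RV P >-> R}) (l : R).
Hypotheses (l0 : 0 < l) (XP : is_poisson X l).

Let mu := poisson_prob l 0.
Let natR_measurable : measurable_fun [set: nat] (fun k : nat => k%:R : R).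
Proof. by []. Qed.

Let distE : forall f : R -> \bar R, (\int[distribution P X]_x f x =
  \int[pushforward mu (fun k : nat => k%:R : R)]_x f x)%E.
Proof. by move=> f; apply: eq_measure_integral => A mA _; exact: XP. Qed.

Lemma ge0_integral_is_poisson (f : R -> R) :
  measurable_fun setT f -> (forall x, 0 <= f x) ->
  (\int[P]_w (f (X w))%:E = \int[mu]_k (f k%:R)%:E)%E.
Proof.
move=> mf f0.
have mEf : measurable_fun setT (EFin \o f) by exact/measurable_EFinP.
rewrite -(@ge0_integral_distribution _ _ _ _ _ _ X (EFin \o f))// distE.
by rewrite ge0_integral_pushforward// => x _; rewrite lee_fin.
Qed.

Lemma is_poisson_mean : ('E_P[X] = l%:E)%E.
Proof.
(* [EFin] takes both signs on the reals, so integrability comes first, from the nonnegative case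
   applied to [normr]. *)
have ifin : (\int[P]_w `|(X w)%:E| < +oo)%E.
  rewrite (@ge0_integral_is_poisson normr)//.
  under eq_integral do rewrite normr_nat.
  by rewrite poisson_mean// ltry.
rewrite unlock -(@integral_distribution _ _ _ _ _ _ X EFin)//; last first.
  apply/integrableP; split => //; exact/measurable_EFinP.
rewrite distE integral_pushforward//; first exact: poisson_mean.
apply/integrableP; split => //.
under eq_integral do rewrite /= normr_nat.
by rewrite poisson_mean// ltry.
Qed.

Lemma is_poisson_variance : ('V_P[X] = l%:E)%E.
Proof.
rewrite /variance unlock is_poisson_mean unlock /=.
rewrite -[RHS](poisson_variance l0).
rewrite -(@ge0_integral_is_poisson (fun x => (x - l) ^+ 2)).
- by apply: eq_integral.
- by apply: measurable_funX; exact: measurable_funB.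
- by move=> x; rewrite sqr_ge0.
Qed.

Lemma is_poisson_second_moment :
  ('E_P[(fun w => (X w ^+ 2)%R)] = (l * (l + 1))%:E)%E.
Proof.
rewrite unlock -(poisson_second_moment l0).
rewrite (@ge0_integral_is_poisson (fun x => x ^+ 2))// => x.
by rewrite sqr_ge0.
Qed.

Lemma is_poisson_centered_prob : centered_prob X =
  fine (mu [set k | `|k%:R - l| < Num.sqrt l]).
Proof.
rewrite /centered_prob is_poisson_mean is_poisson_variance /=.
have mA : measurable [set x : R | `|x - l| < Num.sqrt l].
  rewrite (_ : [set _ | _] = ball l (Num.sqrt l)).
    by apply: open_measurable; exact: ball_open.
  by apply/seteqP; split => x; rewrite /ball/= distrC.
by have /(congr1 fine) := XP mA.
Qed.

End poisson_rv.

(** * Lower bound for the central probability *)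

Lemma poisson_central1 (R : realType) :
  fine (poisson_prob 1 0 [set k | `|k%:R - 1| < Num.sqrt (1 : R)]) =
  expR (-1) :> R.
Proof.
rewrite (_ : [set _ | _] = [set 1%N]).
  by rewrite poisson_prob1//= poisson_pmfE// /exp_coeff/= expr1n divr1 mul1r.
rewrite sqrtr1; apply/seteqP; split => k /=; last first.
  by move=> ->; rewrite subrr normr0.
rewrite ltr_norml => /andP[].
rewrite ltrBrDr addNr ltr0n ltrBlDr.
by rewrite (ltr_nat _ k 2) => ? ?; apply/eqP; rewrite eqn_leq -ltnS; apply/andP.
Qed.

Lemma poisson_central_ge (R : realType) (l : R) : 0 < l ->
  expR (-1) <= fine (poisson_prob l 0 [set k | `|k%:R - l| < Num.sqrt l]).
Proof.
move=> l0.
(* It suffices to find a block of consecutive integers inside the interval whose weights total at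
   least [expR (l - 1)]. *)
have key (i j : nat) : (forall k, (i <= k < j)%N -> `|k%:R - l| < Num.sqrt l) ->
    expR l <= expR 1 * \sum_(i <= k < j) exp_coeff l k ->
    expR (-1) <= fine (poisson_prob l 0 [set k | `|k%:R - l| < Num.sqrt l]).
  move=> sub le.
  rewrite -lee_fin fineK; last by rewrite fin_num_measure.
  apply: (@le_trans _ _ (poisson_prob l 0 [set k | (i <= k < j)%N]));
    last first.
    by apply: le_measure; rewrite ?inE//.
  rewrite poisson_probE//.
  rewrite (_ : [set k | _] = [set` index_iota i j]); last first.
    by apply/seteqP; split => k /=; rewrite mem_index_iota.
  rewrite esum_fset; [|exact: finite_seq|]; last first.
    by move=> k _; rewrite lee_fin poisson_pmf_ge0.
  rewrite -fsbig_seq ?iota_uniq//= sumEFin lee_fin.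
  under eq_bigr do rewrite poisson_pmfE//.
  rewrite -mulr_suml !expRN -ler_pdivrMr ?invr_gt0 ?expR_gt0// invrK mulrC.
  by rewrite ler_pdivrMr ?expR_gt0// mulrC.
(* For [l < 1] the block {0} is enough: [l < Num.sqrt l], its weight is 1 and [expR l <= expR 1]. *)
have [l1|l1] := ltP l 1.
  apply: (key 0%N 1%N) => [k|].
    rewrite andbC leq0n andbT ltnS leqn0 => /eqP ->.
    rewrite sub0r normrN gtr0_norm// -{1}(sqr_sqrtr (ltW l0)).
    rewrite expr2 gtr_pMl ?sqrtr_gt0//.
    by rewrite -(@sqrtr1 R) ltr_sqrt.
  by rewrite big_nat1 /exp_coeff/= expr0 divr1 mulr1 ler_expR ltW.
move: l1; rewrite le_eqVlt => /predU1P[<-|l1].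
  by rewrite poisson_central1.
have [a [m [sub le]]] := exp_coeff_central l1.
apply: (key a.+1 m) => //; apply: le_trans le _.
by rewrite ler_wpM2r ?expR1_ge// sumr_ge0// => k _; rewrite exp_coeff_ge0// ltW.
Qed.

(** * Sums of independent Poisson variables and infinite divisibility *)

Definition mfun_of d d' (T : measurableType d) (T' : measurableType d')
  (f : T -> T') (mf : measurable_fun setT f) : {mfun T >-> T'} :=
  HB.pack f (isMeasurableFun.Build d d' T T' f mf).

(** The binomial theorem divided by the factorial of [k]; this convolution is why Poisson rates
    add. *)
Lemma exp_coeffD (R : realType) (x y : R) (k : nat) :
  exp_coeff (x + y) k = \sum_(j < k.+1) exp_coeff x (k - j)%N * exp_coeff y j.
Proof.
rewrite /exp_coeff/= exprDn mulr_suml; apply: eq_bigr => j _.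
have jk : (j <= k)%N by rewrite -ltnS.
have f0 m : m`!%:R != 0 :> R by rewrite pnatr_eq0 -lt0n fact_gt0.
rewrite -[X in X / _]mulr_natr -(bin_fact jk) !natrM.
have C0 : 'C(k, j)%:R != 0 :> R by rewrite pnatr_eq0 -lt0n bin_gt0.
by field; rewrite !f0 C0.
Qed.

Lemma measurable_fun_sumn d (T : measurableType d) (I : Type) (s : seq I)
    (f : I -> T -> nat) : (forall i, measurable_fun setT (f i)) ->
  measurable_fun setT (fun w => \sum_(i <- s) f i w)%N.
Proof.
move=> mf; elim: s => [|i s ih].
  by under eq_fun do rewrite big_nil; exact: measurable_cst.
under eq_fun do rewrite big_cons; exact: measurable_fun_addn.
Qed.

Lemma measure_nat_esum (R : realType) (mu : {measure set nat -> \bar R})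
    (A : set nat) : mu A = (\esum_(k in A) mu [set k])%E.
Proof.
have -> : mu A = mu (\bigcup_(k in A) [set k]).
  by rewrite bigcup_imset1 image_id.
rewrite measure_bigcup//; last exact: trivIset_singletons.
by rewrite nneseries_esum// set_mem_set.
Qed.

(* The law of the sum is stated through [exp_coeff] because the induction starts
   at rate 0, where [poisson_pmf] takes the junk value 1. *)
Lemma iid_poisson (R : realType) (l : R) (n : nat) : 0 < l ->
  exists (d : measure_display) (T : measurableType d) (P : probability T R)
    (Z : 'I_n -> T -> nat),
  [/\ forall i, measurable_fun setT (Z i),
      forall B : 'I_n -> set nat, P (\bigcap_i (Z i @^-1` B i)) =
        (\prod_(i < n) poisson_prob l 0 (B i))%E &
      forall k, P ((fun w => \sum_(i < n) Z i w)%N @^-1` [set k]) =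
        (exp_coeff (n%:R * l) k * expR (- (n%:R * l)))%:E].
Proof.
move=> l0; elim: n => [|n [d [T [P [Z [mZ PZ PS]]]]]].
  exists _, unit, (dirac tt), (fun _ _ => 0%N); split => //.
  - move=> B; rewrite big_ord0 -[RHS](diracT R tt); congr (dirac _ _).
    by apply/seteqP; split => // w _ [].
  - move=> k; rewrite mul0r oppr0 expR0 mulr1 /exp_coeff/= /dirac/= indicE.
    case: k => [|k]; last first.
      by rewrite expr0n mul0r memNset//= big_ord0.
    by rewrite expr0 divr1 mem_set//= big_ord0.
pose mu : probability nat R := poisson_prob l 0.
(* The new variable is the second coordinate of the product space and takes index 0; the old ones
   are shifted. *)
pose Z' (i : 'I_n.+1) (w : T * nat) : nat :=
  if unlift ord0 i is Some j then Z j w.1 else w.2.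
have Z'0 w : Z' ord0 w = w.2 by rewrite /Z' unlift_none.
have Z'S j w : Z' (lift ord0 j) w = Z j w.1 by rewrite /Z' liftK.
exists _, (T * nat)%type, (P \x mu)%E, Z'; split.
- move=> i; rewrite /Z'; case: (unlift ord0 i) => [j|].
    exact: measurableT_comp.
  exact: measurable_snd.
- move=> B.
  have -> : \bigcap_i (Z' i @^-1` B i) =
      (\bigcap_i (Z i @^-1` B (lift ord0 i))) `*` B ord0.
    apply/seteqP; split => [w Bw|w [Bw1 Bw2] i _].
      split => [j _|].
        by have := Bw (lift ord0 j) Logic.I; rewrite /= Z'S.
      by have := Bw ord0 Logic.I; rewrite /= Z'0.
    have [j ->|->] := unliftP ord0 i; rewrite /= ?Z'0//.
    by rewrite Z'S; exact: Bw1.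
  rewrite [LHS]product_measure1E//; last first.
    apply: fin_bigcap_measurable => // i _.
    by rewrite -[X in measurable X]setTI; exact: mZ.
  rewrite big_ord_recl muleC; congr (_ * _)%E.
  exact: (PZ (fun i => B (lift ord0 i))).
- move=> k; pose S w := (\sum_(i < n) Z i w)%N.
  have mS : measurable_fun setT S by exact: measurable_fun_sumn.
  (* Splitting on the value [j] of the new variable gives disjoint rectangles, whose measures form
     the convolution of the two laws. *)
  have -> : (fun w => \sum_(i < n.+1) Z' i w)%N @^-1` [set k] =
      \bigcup_(j in `I_k.+1) ((S @^-1` [set (k - j)%N]) `*` [set j]).
    apply/seteqP; split => w /=.
      rewrite big_ord_recl Z'0; under eq_bigr do rewrite Z'S.
      move=> wk; exists w.2 => /=; first by rewrite ltnS -wk leq_addr.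
      by split => //; rewrite -wk addKn.
    move=> [j /= jk [/= Sw wj]]; rewrite big_ord_recl Z'0.
    under eq_bigr do rewrite Z'S.
    by rewrite wj -/(S w.1) Sw subnKC.
  rewrite measure_fin_bigcup//=; last 2 first.
  - by move=> i j _ _ [w [[_ /= <-] [_ /= <-]]].
  - move=> j _; apply: measurableX => //.
    by rewrite -[X in measurable X]setTI; exact: mS.
  rewrite -fsbig_ord.
  transitivity (\sum_(j < k.+1)
    (exp_coeff (n%:R * l) (k - j)%N * expR (- (n%:R * l)) *
     (exp_coeff l j * expR (- l)))%:E)%E.
    apply: eq_bigr => j _; rewrite [LHS]product_measure1E//; last first.
      by rewrite -[X in measurable X]setTI; exact: mS.
    rewrite EFinM; congr (_ * _)%E; first exact: PS.
    by rewrite -poisson_pmfE//; exact: poisson_prob1.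
  rewrite sumEFin -natr1 mulrDl mul1r exp_coeffD opprD expRD; congr EFin.
  by rewrite mulr_suml; apply: eq_bigr => j _; ring.
Qed.

Lemma is_poisson_infinitely_divisible d (T : measurableType d) (R : realType)
    (P : probability T R) (X : {RV P >-> R}) (l : R) :
  0 < l -> is_poisson X l -> infinitely_divisible X.
Proof.
move=> l0 XP n n0.
have ln0 : 0 < l / n%:R by rewrite divr_gt0// ltr0n.
have [d' [T' [P' [Z [mZ PZ PS]]]]] := iid_poisson n ln0.
pose natR : nat -> R := fun k => k%:R.
have mnatR : measurable_fun setT natR by [].
pose Y i : {RV P' >-> R} := mfun_of (measurableT_comp mnatR (mZ i)).
have PY i (A : set R) :
    P' (Y i @^-1` A) = poisson_prob (l / n%:R) 0 (natR @^-1` A).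
  (* The marginal law is the joint law with full sets at all other indices. *)
  have := PZ (fun j => if j == i then natR @^-1` A else setT).
  rewrite (bigD1 i)//= eqxx big1 ?mule1; last first.
    by move=> j /negbTE ->; exact: probability_setT.
  move=> <-; congr (P' _); apply/seteqP; split => w.
    by move=> Aw j _; case: eqP => [->|].
  by move=> /(_ i Logic.I); rewrite /= eqxx.
exists d', T', P', Y; split.
- move=> J B mB.
  under eq_bigr do rewrite PY.
  (* Indices outside [J] are padded with the full set, of probability 1. *)
  transitivity (P' (\bigcap_i (Z i @^-1`
      (if i \in J then natR @^-1` B i else setT)))).
    congr (P' _); apply/seteqP; split => w Bw i.
      by move=> _ /=; case: ifPn => // iJ; exact: Bw.
    by move=> /= iJ; have := Bw i Logic.I; rewrite /= iJ.
  rewrite PZ [RHS]big_mkcond; apply: eq_bigr => i _.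
  by case: ifPn => // _; exact: probability_setT.
- by move=> i j A mA; rewrite !PY.
- move=> A mA; rewrite [LHS](XP A mA).
  have mS : measurable_fun setT (fun w => \sum_(i < n) Z i w)%N.
    exact: measurable_fun_sumn.
  have -> : (fun w => \sum_(i < n) Y i w) @^-1` A =
      (fun w => \sum_(i < n) Z i w)%N @^-1` (natR @^-1` A).
    by apply/seteqP; split => w /=; rewrite /natR natr_sum.
  (* The two laws are compared atom by atom, the total rate being [n%:R * (l / n%:R) = l]. *)
  rewrite [RHS](measure_nat_esum (distribution P' (mfun_of mS))).
  rewrite poisson_probE//.
  apply: eq_esum => k _; rewrite poisson_pmfE//.
  have <- : n%:R * (l / n%:R) = l by rewrite mulrC divfK// pnatr_eq0 -lt0n.
  by rewrite -PS.
Qed.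

(** * Attainment of the bound and conclusion *)

Lemma expRN1_I0_probs (R : realType) : I0_probs (expR (-1) : R).
Proof.
pose P : probability nat R := poisson_prob 1 0.
have mnatR : measurable_fun [set: nat] (fun k : nat => k%:R : R) by [].
pose X : {RV P >-> R} := mfun_of mnatR.
have XP : is_poisson X 1 by [].
exists _, nat, P, X; split.
- exact: is_poisson_infinitely_divisible XP.
- by rewrite (is_poisson_second_moment ltr01 XP) ltry.
- by rewrite (is_poisson_variance ltr01 XP) lte_fin.
- by rewrite (is_poisson_centered_prob ltr01 XP) poisson_central1.
Qed.

Theorem theorem4p2 (R : realType) :
  (forall (d : measure_display) (T : measurableType d) (P : probability T R)
          (N : R -> {RV P >-> R}),
     (forall l : R, 0 < l -> is_poisson (N l) l) ->
     inf [set centered_prob (N l) | l in `]0, +oo[] = centered_prob (N 1)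
     /\ centered_prob (N 1) = expR (-1)) /\
  inf (@I0_probs R) <= expR (-1).
Proof.
split.
  move=> d T P N NP.
  have N1 : centered_prob (N 1) = expR (-1).
    by rewrite (is_poisson_centered_prob ltr01 (NP _ ltr01)) poisson_central1.
  split => //; apply/eqP; rewrite eq_le; apply/andP; split.
    (* A real [inf] bounds its set from below only if the set has a lower bound; here 0, as
       probabilities are nonnegative. *)
    apply: ge_inf.
      exists 0 => _ [l _ <-]; exact: fine_ge0.
    by exists 1 => //=; rewrite in_itv/= ltr01.
  apply: lb_le_inf.
    by exists (centered_prob (N 1)), 1 => //=; rewrite in_itv/= ltr01.
  move=> x [l /=]; rewrite in_itv/= andbT => l0 <-.
  by rewrite N1 (is_poisson_centered_prob l0 (NP _ l0)) poisson_central_ge.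
apply: ge_inf; last exact: expRN1_I0_probs.
by exists 0 => _ [d [T [P [X [_ _ _ ->]]]]]; exact: fine_ge0.
Qed.
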